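(* Let $\lambda$ be a highest weight (for $\mathfrak{e}_7$) as in Case 3 (defined in the context) such that the strict basic Dirac inequality $\|(\lambda-s_1)^{+}+\rho\|^2>\|\lambda+\rho\|^2$ holds. Then $$\|(\lambda-s_{a,b,c})^{+}+\rho\|^2>\|\lambda+\rho\|^2\qquad\text{for all } a,b,c\in\mathbb{N}_0,\ (a,b,c)\neq(0,0,0).$$
   Context: Setting for $\mathfrak{e}_7$ (Hermitian case). Work in $\mathbb{R}^8$ with the standard inner product $\langle\cdot,\cdot\rangle$ and norm $\|\cdot\|$, and let $\mathbb{N}_0=\{0,1,2,\dots\}$. Let $\varepsilon_i$ be the $i$-th coordinate functional, identified with the $i$-th standard basis vector. Put $\rho=\left(0,1,2,3,4,5,-\frac{17}{2},\frac{17}{2}\right)$ and $\alpha_1=\frac12(\varepsilon_8-\varepsilon_7-\varepsilon_6-\varepsilon_5-\varepsilon_4-\varepsilon_3-\varepsilon_2+\varepsilon_1)$. The group $W_{\mathfrak{k}}$ is generated by the reflections $s_\alpha(\mu)=\mu-\frac{2\langle\mu,\alpha\rangle}{\langle\alpha,\alpha\rangle}\alpha$ for $\alpha=\varepsilon_i\pm\varepsilon_j$ ($5\ge i>j\ge1$) and $\alpha=\alpha_1$. For $\mu\in\mathbb{R}^8$, $\mu^{+}$ denotes the unique $W_{\mathfrak{k}}$-conjugate of $\mu$ that is $\mathfrak{k}$-dominant, i.e. satisfies $|\mu_1|\le\mu_2\le\mu_3\le\mu_4\le\mu_5$ and $\frac12(\mu_8-\mu_7-\mu_6-\mu_5-\mu_4-\mu_3-\mu_2+\mu_1)\ge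 0$. A highest weight is a real vector $\lambda=(\lambda_1,\dots,\lambda_6,\lambda_7,-\lambda_7)$ (so $\lambda_8=-\lambda_7$) with $|\lambda_1|\le\lambda_2\le\lambda_3\le\lambda_4\le\lambda_5$, with $\lambda_i-\lambda_j\in\mathbb{Z}$ and $2\lambda_i\in\mathbb{Z}$ for $i,j\in\{1,\dots,5\}$, and with $m(\lambda):=\frac12(\lambda_8-\lambda_7-\lambda_6-\lambda_5-\lambda_4-\lambda_3-\lambda_2+\lambda_1)\in\mathbb{N}_0$. The basic Schmid modules are (represented by) $s_1=(0,0,0,0,0,0,-1,1)$, $s_2=(0,0,0,0,1,1,-1,1)$, $s_3=(0,0,0,0,0,2,-1,1)$. A general Schmid module is $s_{a,b,c}=a s_1+b s_2+c s_3$ with $a,b,c\in\mathbb{N}_0$, $a+b+c>0$. Case 3: a highest weight $\lambda$ is as in Case 3 if one of the following holds: $m(\lambda)\ge1$; or $m(\lambda)=0$ and one of: $\lambda_1<\lambda_2$; $\lambda_1=\lambda_2<\lambda_3$; $0<\lambda_1=\lambda_2=\lambda_3<\lambda_4$; $0=\lambda_1=\lambda_2=\lambda_3<\lambda_4$; $0<\lambda_1=\lambda_2=\lambda_3=\lambda_4<\lambda_5$; $0<\lambda_1=\lambda_2=\lambda_3=\lambda_4=\lambda_5$. (Equivalently: $m(\lambda)\ge 1$, or $m(\lambda)=0$ and $(\lambda_1,\lambda_2,\lambda_3,\lambda_4)\ne(0,0,0,0)$.) *)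

(* Defs.v *)
From mathcomp Require Import all_boot all_order all_algebra.
From mathcomp Require Import boolp classical_sets reals.

Set Implicit Arguments.
Unset Strict Implicit.
Unset Printing Implicit Defensive.

Import Order.TTheory GRing.Theory Num.Theory.
Local Open Scope ring_scope.

Section HermitianE7.
Variable R : realType.
Implicit Types mu nu lambda alpha : 'rV[R]_8.

(* Coordinates are numbered from 1 to 8, as in the usual realization of E7
   in R^8; other values of k are never used. *)
Definition coord mu (k : nat) : R := mu 0 (inord k.-1).

Definition eps (k : nat) : 'rV[R]_8 := delta_mx 0 (inord k.-1).

Definition vec8 (s : seq R) : 'rV[R]_8 := \row_(i < 8) s`_i.

Definition dot mu nu : R := \sum_(i < 8) mu 0 i * nu 0 i.

Definition enorm mu : R := Num.sqrt (dot mu mu).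

Definition rho : 'rV[R]_8 :=
  vec8 [:: 0; 1; 2; 3; 4; 5; - (17 / 2); 17 / 2].

Definition alpha1 : 'rV[R]_8 :=
  2^-1 *: (eps 8 - eps 7 - eps 6 - eps 5 - eps 4 - eps 3 - eps 2 + eps 1).

Definition reflection alpha mu : 'rV[R]_8 :=
  mu - (2 * dot mu alpha / dot alpha alpha) *: alpha.

Definition is_generator_root alpha : Prop :=
  (exists i j : nat, (1 <= j < i)%N /\ (i <= 5)%N /\
     (alpha = eps i + eps j \/ alpha = eps i - eps j))
  \/ alpha = alpha1.

(* W_k, as the group of transformations of R^8 generated by the reflections. *)
Inductive Wk : ('rV[R]_8 -> 'rV[R]_8) -> Prop :=
| Wk_id : Wk id
| Wk_refl alpha : is_generator_root alpha -> Wk (reflection alpha)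
| Wk_comp w1 w2 : Wk w1 -> Wk w2 -> Wk (w1 \o w2)
| Wk_inv w w' : Wk w -> cancel w w' -> cancel w' w -> Wk w'.

Definition m mu : R :=
  2^-1 * (coord mu 8 - coord mu 7 - coord mu 6 - coord mu 5 - coord mu 4
          - coord mu 3 - coord mu 2 + coord mu 1).

Definition k_dominant mu : Prop :=
  [/\ `|coord mu 1| <= coord mu 2, coord mu 2 <= coord mu 3,
      coord mu 3 <= coord mu 4, coord mu 4 <= coord mu 5 & 0 <= m mu].

(* W_k is a finite reflection group (of type E6) and the k-dominant vectors
   form a closed fundamental chamber for it, so exactly one vector satisfies
   the condition below; the default value 0 of xget plays no role. *)
Definition dominant_conj mu : 'rV[R]_8 :=
  xget 0 [set nu | (exists w, Wk w /\ nu = w mu) /\ k_dominant nu]%classic.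

Definition highest_weight lambda : Prop :=
  coord lambda 8 = - coord lambda 7 /\
  [/\ `|coord lambda 1| <= coord lambda 2, coord lambda 2 <= coord lambda 3,
      coord lambda 3 <= coord lambda 4 & coord lambda 4 <= coord lambda 5] /\
  (forall i j : nat, (1 <= i <= 5)%N -> (1 <= j <= 5)%N ->
     coord lambda i - coord lambda j \is a Num.int) /\
  (forall i : nat, (1 <= i <= 5)%N -> 2 * coord lambda i \is a Num.int) /\
  m lambda \is a Num.nat.

Definition case3 lambda : Prop :=
  let l := coord lambda in
  1 <= m lambda \/
  (m lambda = 0 /\
    (l 1 < l 2 \/
     (l 1 = l 2 /\ l 2 < l 3) \/
     [/\ 0 < l 1, l 1 = l 2, l 2 = l 3 & l 3 < l 4] \/
     [/\ 0 = l 1, l 1 = l 2, l 2 = l 3 & l 3 < l 4] \/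
     [/\ 0 < l 1, l 1 = l 2, l 2 = l 3, l 3 = l 4 & l 4 < l 5] \/
     [/\ 0 < l 1, l 1 = l 2, l 2 = l 3, l 3 = l 4 & l 4 = l 5])).

Definition s1 : 'rV[R]_8 := vec8 [:: 0; 0; 0; 0; 0; 0; -1; 1].
Definition s2 : 'rV[R]_8 := vec8 [:: 0; 0; 0; 0; 1; 1; -1; 1].
Definition s3 : 'rV[R]_8 := vec8 [:: 0; 0; 0; 0; 0; 2; -1; 1].

Definition schmid (a b c : nat) : 'rV[R]_8 :=
  a%:R *: s1 + b%:R *: s2 + c%:R *: s3.

End HermitianE7.

Arguments rho {R}.
Arguments s1 {R}.
Arguments schmid {R} a b c.

(* Main.v *)
(* Decompose R^8 into the span of the E6 roots of W_k and its orthogonal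
   complement; the component of rho in the latter is (9/2) s3, and 2 rho - 9 s3 is
   the sum of the positive roots.  The function N(mu), the sum of |<mu, alpha>|
   over the positive roots alpha, is W_k-invariant and equals <mu, 2 rho - 9 s3>
   for dominant mu, so
     |mu^+ + rho|^2 = |mu|^2 + N(mu) + 9 <mu, s3> + |rho|^2,
   which no longer mentions mu^+.  Let e_alpha be -1 if <lambda, alpha> = 0 and
   1 otherwise, and let L(s) be the sum of e_alpha <s, alpha>.  By integrality
   N(lambda - s) >= N(lambda) - L(s), with equality for s = s1.  In Case 3 some
   simple root orthogonal to s2 is not orthogonal to lambda, whence L(s1) >= 0 and
   L(2 s1 - s2) >= 0 (a check over the possible sets of simple roots orthogonal to
   lambda).  With n = a + 2b + 3c, subtracting n times the basic inequality from
   the desired one leaves a sum of nonnegative terms, since 2 s1 - s2 and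
   3 s1 - s3 pair nonnegatively with lambda. *)
Require Import Defs.
From mathcomp Require Import all_boot all_order all_algebra.
From mathcomp Require Import boolp classical_sets reals.
From mathcomp Require Import ring lra.
Import Defs.
Set Implicit Arguments.
Unset Strict Implicit.
Unset Printing Implicit Defensive.
Import Order.TTheory GRing.Theory Num.Theory.
Local Open Scope ring_scope.

(** * The E6 root system in integer coordinates *)

(* The simple roots alpha_1, ..., alpha_6 (Bourbaki's numbering) have indices
   0, ..., 5, and a root is encoded by its six coefficients in that basis. *)
Definition cartan (i j : nat) : int :=
  if i == j then 2
  else if (minn i j, maxn i j) \in
            [:: (0, 2); (1, 3); (2, 3); (3, 4); (4, 5)]%N then -1
  else 0.

(* Unlike the locked [\sum], this sum can be evaluated by [vm_compute]. *)
Definition isum (T : Type) (r : seq T) (F : T -> int) : int :=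
  foldr (fun t x => F t + x) 0 r.

Definition form (c d : seq int) : int :=
  isum (iota 0 6) (fun i =>
    c`_i * isum (iota 0 6) (fun j => d`_j * cartan i j)).

Definition boxes (bounds : seq nat) : seq (seq int) :=
  foldr (fun n cs => [seq Posz k :: c | k <- iota 0 n.+1, c <- cs])
    [:: [::]] bounds.

(* In a simply laced root lattice the roots are the vectors of norm 2; the bounds
   are the coefficients of the highest root. *)
Definition pos_roots : seq (seq int) :=
  [seq c <- boxes [:: 1; 2; 2; 3; 2; 1]%N | form c c == 2].

(** Roots have norm 2, so the factor [2 / form d d] of the reflection is 1. *)
Definition reflc (d c : seq int) : seq int :=
  mkseq (fun i => c`_i - form c d * d`_i) 6.

(** The coefficients of a root share a sign, so this selects the positive root among c and -c. *)
Definition posrep (c : seq int) : seq int :=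
  if all (fun x => 0 <= x) c then c else map -%R c.

(* Here z marks the simple roots orthogonal to a dominant vector; a positive root
   is orthogonal to it iff its support is contained in z. *)
Definition sgnc (z : seq bool) (c : seq int) : int :=
  if all (fun i => nth true z i || (c`_i == 0)) (iota 0 6) then -1 else 1.

(* In the notation above, L(s1) is [sgnsum z 0] and L(s2) is [sgnsum z 5]. *)
Definition sgnsum (z : seq bool) (i : nat) : int :=
  isum pos_roots (fun c => sgnc z c * c`_i).

(** The source of the invariance of N under reflections. *)
Lemma pos_roots_reflc :
  all (fun d => perm_eq [seq posrep (reflc d c) | c <- pos_roots] pos_roots)
    pos_roots.
Proof. by vm_compute. Qed.

Lemma sum_pos_roots :
  [seq isum pos_roots (fun c => c`_i) | i <- iota 0 6] =
  [:: 16; 22; 30; 42; 30; 16].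
Proof. by vm_compute. Qed.

Definition bitseqs n : seq bitseq :=
  iter n (fun zs => map (cons true) zs ++ map (cons false) zs) [:: [::]].

Lemma mem_bitseqs n (z : bitseq) : size z = n -> z \in bitseqs n.
Proof.
move=> <-; elim: z => [//|b z IH] /=.
by rewrite mem_cat; case: b; rewrite (map_f _ IH) ?orbT.
Qed.

(** [take 5] leaves out alpha_6, the only simple root not orthogonal to s2. All 64 patterns are
    checked. *)
Lemma sgnsum_bounds z : size z = 6 -> ~~ all id (take 5 z) ->
  0 <= sgnsum z 0 /\ sgnsum z 5 <= 2 * sgnsum z 0.
Proof.
move=> /mem_bitseqs z6 nz; apply/andP; move: z nz z6.
suff /allP H : all (fun z => all id (take 5 z) ||
    (0 <= sgnsum z 0) && (sgnsum z 5 <= 2 * sgnsum z 0)) (bitseqs 6).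
  by move=> z /negPf nz /H; rewrite nz.
by vm_compute.
Qed.

Section E7.
Variable R : realType.
Implicit Types (mu nu xi lambda : 'rV[R]_8) (c d : seq int) (i j k : nat).

(** * The inner product in coordinates *)

Lemma dotE mu nu :
  dot mu nu = coord mu 1 * coord nu 1 + coord mu 2 * coord nu 2
    + coord mu 3 * coord nu 3 + coord mu 4 * coord nu 4
    + coord mu 5 * coord nu 5 + coord mu 6 * coord nu 6
    + coord mu 7 * coord nu 7 + coord mu 8 * coord nu 8.
Proof.
rewrite /dot (eq_bigr (fun i : 'I_8 => mu 0 (inord i) * nu 0 (inord i))).
  by rewrite !big_ord_recl big_ord0 /= addr0 !addrA.
by move=> i _; rewrite inord_val.
Qed.

Lemma coordD mu nu k : coord (mu + nu) k = coord mu k + coord nu k.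
Proof. by rewrite /coord mxE. Qed.

Lemma coordN mu k : coord (- mu) k = - coord mu k.
Proof. by rewrite /coord mxE. Qed.

Lemma coordZ (a : R) mu k : coord (a *: mu) k = a * coord mu k.
Proof. by rewrite /coord mxE. Qed.

Lemma coord_eps i k : (0 < i <= 8)%N -> (0 < k <= 8)%N ->
  coord (eps R i) k = (i == k)%:R.
Proof.
case: i k => [|i] [|k] //= i8 k8; rewrite /coord /eps mxE eqxx /=.
by rewrite -val_eqE /= !inordK // eqSS eq_sym.
Qed.

Lemma coord_vec8 (s : seq R) k : (0 < k <= 8)%N -> coord (vec8 s) k = s`_k.-1.
Proof. by case: k => [//|k] k8; rewrite /coord mxE inordK. Qed.

Definition coord_simpl := (coordD, coordN, coordZ, coord_vec8, coord_eps).

Lemma dotC mu nu : dot mu nu = dot nu mu.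
Proof. by apply: eq_bigr => i _; rewrite mulrC. Qed.

Lemma dotDl mu nu xi : dot (mu + nu) xi = dot mu xi + dot nu xi.
Proof. by rewrite -big_split; apply: eq_bigr => i _; rewrite mxE mulrDl. Qed.

Lemma dotZl (a : R) mu xi : dot (a *: mu) xi = a * dot mu xi.
Proof. by rewrite /dot mulr_sumr; apply: eq_bigr => i _; rewrite mxE mulrA. Qed.

Lemma dotBl mu nu xi : dot (mu - nu) xi = dot mu xi - dot nu xi.
Proof. by rewrite dotDl -scaleN1r dotZl mulN1r. Qed.

Lemma dotDr xi mu nu : dot xi (mu + nu) = dot xi mu + dot xi nu.
Proof. by rewrite dotC dotDl !(dotC xi). Qed.

Lemma dotZr (a : R) xi mu : dot xi (a *: mu) = a * dot xi mu.
Proof. by rewrite dotC dotZl dotC. Qed.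

Lemma dotBr xi mu nu : dot xi (mu - nu) = dot xi mu - dot xi nu.
Proof. by rewrite dotC dotBl !(dotC xi). Qed.

Lemma dot0r xi : dot xi 0 = 0.
Proof. by rewrite -(scale0r 0) dotZr mul0r. Qed.

Lemma dot_sumr xi (I : Type) (r : seq I) (F : I -> 'rV[R]_8) :
  dot xi (\sum_(i <- r) F i) = \sum_(i <- r) dot xi (F i).
Proof. exact: (big_morph (dot xi) (dotDr xi) (dot0r xi)). Qed.

Lemma enorm_sqr mu : enorm mu ^+ 2 = dot mu mu.
Proof. by rewrite sqr_sqrtr //; apply: sumr_ge0 => i _; apply: sqr_ge0. Qed.

(** * Roots as vectors of R^8 *)

Definition simple k : 'rV[R]_8 :=
  nth 0 [:: alpha1 R; eps R 2 + eps R 1; eps R 2 - eps R 1; eps R 3 - eps R 2;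
            eps R 4 - eps R 3; eps R 5 - eps R 4] k.

Definition root c : 'rV[R]_8 := \sum_(i <- iota 0 6) (c`_i)%:~R *: simple i.

Lemma dot_root mu c :
  dot mu (root c) = \sum_(i <- iota 0 6) (c`_i)%:~R * dot mu (simple i).
Proof. by rewrite dot_sumr; apply: eq_bigr => i _; rewrite dotZr. Qed.

Lemma dot_eps mu k : (0 < k <= 8)%N -> dot mu (eps R k) = coord mu k.
Proof.
case: k => [//|k] /= k8; rewrite /dot (bigD1 (inord k)) //= big1 ?addr0.
  by rewrite mxE !eqxx mulr1.
by move=> i ik; rewrite mxE (negPf ik) mulr0.
Qed.

Lemma dot_simpleE mu k :
  dot mu (simple k) =
  nth 0 [:: m mu; coord mu 2 + coord mu 1; coord mu 2 - coord mu 1;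
            coord mu 3 - coord mu 2; coord mu 4 - coord mu 3;
            coord mu 5 - coord mu 4] k.
Proof.
case: k => [|[|[|[|[|[|k]]]]]]; rewrite /simple /= /alpha1.
all: by rewrite ?nth_nil ?dot0r // ?dotZr !(dotBr, dotDr) !dot_eps.
Qed.

Lemma dot_simple i j : (i < 6)%N -> (j < 6)%N ->
  dot (simple i) (simple j) = (cartan i j)%:~R.
Proof.
move=> i6 j6; rewrite dot_simpleE.
case: i i6 => [|[|[|[|[|[|i]]]]]] // _;
  rewrite /simple /= /m /alpha1 !coord_simpl //=;
  case: j j6 => [|[|[|[|[|[|j]]]]]] // _; rewrite /cartan /=; lra.
Qed.

Lemma dot_simple_rho k : (k < 6)%N -> dot rho (simple k) = 1.
Proof.
move=> k6; rewrite dot_simpleE /m !coord_simpl //=.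
by case: k k6 => [|[|[|[|[|[|k]]]]]] //= _; lra.
Qed.

(** On the span of the roots, [s1] and [s2] act as the fundamental weights of alpha_1 and
    alpha_6. *)
Lemma dot_s1_simple k : (k < 6)%N -> dot s1 (simple k) = (k == 0)%:R.
Proof.
move=> k6; rewrite dot_simpleE /m !coord_simpl //=.
by case: k k6 => [|[|[|[|[|[|k]]]]]] //= _; lra.
Qed.

Lemma dot_s2_simple k : (k < 6)%N -> dot (s2 R) (simple k) = (k == 5)%:R.
Proof.
move=> k6; rewrite dot_simpleE /m !coord_simpl //=.
by case: k k6 => [|[|[|[|[|[|k]]]]]] //= _; lra.
Qed.

Lemma dot_s3_simple k : (k < 6)%N -> dot (s3 R) (simple k) = 0.
Proof.
move=> k6; rewrite dot_simpleE /m !coord_simpl //=.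
by case: k k6 => [|[|[|[|[|[|k]]]]]] //= _; lra.
Qed.

Lemma isum_intr (T : Type) (r : seq T) (F : T -> int) :
  (isum r F)%:~R = \sum_(t <- r) (F t)%:~R :> R.
Proof.
by elim: r => [|t r IH]; rewrite ?big_nil // big_cons -IH rmorphD.
Qed.

Lemma dot_root_root c d : dot (root c) (root d) = (form c d)%:~R.
Proof.
rewrite dotC dot_root /form (isum_intr (iota 0 6)).
apply: eq_big_seq => i; rewrite mem_iota => i6.
rewrite intrM (isum_intr (iota 0 6)) dotC dot_root; congr (_ * _).
apply: eq_big_seq => j; rewrite mem_iota => j6.
by rewrite intrM dot_simple.
Qed.

Lemma root_reflc d c : root (reflc d c) = root c - (form c d)%:~R *: root d.
Proof.
rewrite /root scaler_sumr -sumrB.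
apply: eq_big_seq => i; rewrite mem_iota => /= i6.
by rewrite nth_mkseq // intrB intrM scalerA scalerBl.
Qed.

Lemma dot_reflection d mu c : d \in pos_roots ->
  dot (reflection (root d) mu) (root c) = dot mu (root (reflc d c)).
Proof.
rewrite mem_filter => /andP[/eqP d2 _].
rewrite /reflection dotBl dotZl root_reflc dotBr dotZr (dotC (root d) (root c)).
by rewrite !dot_root_root d2; field.
Qed.

(** * The function N and the other invariants of W_k *)

Definition abs_root_sum mu : R := \sum_(c <- pos_roots) `|dot mu (root c)|.

Definition root_sum mu : R := \sum_(c <- pos_roots) dot mu (root c).

Lemma abs_dot_posrep mu c : size c = 6 ->
  `|dot mu (root (posrep c))| = `|dot mu (root c)|.
Proof.
move=> c6; rewrite /posrep; case: ifP => // _.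
rewrite -normrN; congr `|_|.
rewrite !dot_root -sumrN; apply: eq_big_seq => i; rewrite mem_iota => /= i6.
by rewrite (nth_map 0) ?c6 // intrN mulNr opprK.
Qed.

(** A reflection is self-adjoint, so it moves onto the roots and permutes them up to signs, which
    the absolute values absorb. *)
Lemma abs_root_sum_reflection d mu : d \in pos_roots ->
  abs_root_sum (reflection (root d) mu) = abs_root_sum mu.
Proof.
move=> dP; have H := allP pos_roots_reflc d dP.
rewrite /abs_root_sum -[RHS](perm_big _ H) big_map; apply: eq_bigr => c _.
by rewrite dot_reflection // abs_dot_posrep // size_mkseq.
Qed.

(* Coefficients of eps i + eps j (coefD) and eps i - eps j (coefB), for j < i. *)
Definition coefD i j : seq int :=
  mkseq (fun k => ((k == 1) + (2 < k <= i) + (1 < k <= j))%N%:Z) 6.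

Definition coefB i j : seq int := mkseq (fun k => (j < k <= i)%N%:Z) 6.

Lemma coef_pos_roots i j : (0 < j)%N -> (j < i)%N -> (i <= 5)%N ->
  coefD i j \in pos_roots /\ coefB i j \in pos_roots.
Proof.
move=> j0 ji i5; apply/andP.
have /allP H : all (fun i => all (fun j =>
    (coefD i j \in pos_roots) && (coefB i j \in pos_roots)) (iota 1 i.-1))
  (iota 1 5) by vm_compute.
apply: (allP (H i _)); rewrite mem_iota.
  by rewrite (leq_trans _ ji).
by rewrite j0 add1n prednK // (leq_trans _ ji).
Qed.

Lemma root_coef i j : (0 < j)%N -> (j < i)%N -> (i <= 5)%N ->
  eps R i + eps R j = root (coefD i j) /\ eps R i - eps R j = root (coefB i j).
Proof.
move=> j0 ji i5; rewrite /root /= !big_cons !big_nil /simple /=.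
(* alpha_1 has coefficient 0 in all these roots, so it may be any vector. *)
move: (alpha1 R) => a.
case: i i5 ji => [|[|[|[|[|[|i]]]]]] // _;
  case: j j0 => [|[|[|[|[|j]]]]] // _ _.
all: rewrite /= !(scale0r, scale1r) !(add0r, addr0).
all: split; apply/rowP => k.
all: rewrite ![in LHS]mxE ![in RHS]mxE.
all: ring.
Qed.

Lemma generator_root (alpha : 'rV[R]_8) : is_generator_root alpha ->
  exists2 d, d \in pos_roots & alpha = root d.
Proof.
move=> [[i [j [/andP[j1 ji] [i5]]]]|->].
  have [DP BP] := coef_pos_roots j1 ji i5.
  have [-> ->] := root_coef j1 ji i5.
  by case=> ->; [exists (coefD i j)|exists (coefB i j)].
exists [:: 1; 0; 0; 0; 0; 0] => //.
by rewrite /root /= !big_cons big_nil /= !scale0r !addr0 scale1r.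
Qed.

Lemma dot_reflection2 d mu nu : d \in pos_roots ->
  dot (reflection (root d) mu) (reflection (root d) nu) = dot mu nu.
Proof.
rewrite mem_filter => /andP[/eqP d2 _].
rewrite /reflection !(dotBl, dotBr, dotZl, dotZr) !dot_root_root d2.
by rewrite (dotC (root d) nu); field.
Qed.

Lemma dot_root_s3 d : dot (root d) (s3 R) = 0.
Proof.
rewrite dotC dot_root big1_seq // => i /andP[_]; rewrite mem_iota => i6.
by rewrite dot_s3_simple // mulr0.
Qed.

Lemma dot_reflection_s3 d mu :
  dot (reflection (root d) mu) (s3 R) = dot mu (s3 R).
Proof. by rewrite dotBl dotZl dot_root_s3 mulr0 subr0. Qed.

Lemma Wk_invariants (w : 'rV[R]_8 -> 'rV[R]_8) : Wk w ->
  forall mu, [/\ abs_root_sum (w mu) = abs_root_sum mu,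
    dot (w mu) (w mu) = dot mu mu & dot (w mu) (s3 R) = dot mu (s3 R)].
Proof.
elim=> {w} [//|alpha /generator_root [d dP ->] mu|w1 w2 _ H1 _ H2 mu|].
- by rewrite abs_root_sum_reflection // dot_reflection2 // dot_reflection_s3.
- by case: (H1 (w2 mu)) => /= -> -> ->; case: (H2 mu).
(* For an inverse, the invariance of w is applied at w' mu. *)
- move=> w w' _ H _ w'K mu.
  by case: (H (w' mu)); rewrite w'K => -> -> ->.
Qed.

Lemma root_sum_root mu :
  root_sum mu = dot mu (root [:: 16; 22; 30; 42; 30; 16]).
Proof.
rewrite dot_root /root_sum.
under eq_bigr do rewrite dot_root.
rewrite exchange_big /=; apply: (@eq_big_seq _ _ _ _ (iota 0 6)) => i.
rewrite mem_iota => i6; rewrite -mulr_suml -(isum_intr pos_roots).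
congr (_%:~R * _).
by rewrite -sum_pos_roots (nth_map 0%N) ?size_iota // nth_iota.
Qed.

Lemma root_sum_rho mu : root_sum mu = 2 * dot mu rho - 9 * dot mu (s3 R).
Proof.
rewrite root_sum_root dot_root /= !big_cons big_nil !dot_simpleE /= /m.
by rewrite !dotE !coord_simpl //=; field.
Qed.

(** * Dominant vectors and dominant conjugates *)

Definition dominant mu := forall i, (i < 6)%N -> 0 <= dot mu (simple i).

Lemma k_dominantP mu : k_dominant mu <-> dominant mu.
Proof.
split=> [[+ h3 h4 h5 h1]|mu_dom].
  rewrite ler_norml => /andP[h2 h2'] i; rewrite dot_simpleE.
  by case: i => [|[|[|[|[|[|i]]]]]] //= _; lra.
move: (mu_dom 0%N isT) (mu_dom 1%N isT) (mu_dom 2%N isT).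
move: (mu_dom 3%N isT) (mu_dom 4%N isT) (mu_dom 5%N isT).
rewrite !dot_simpleE /= => h3 h4 h5 h0 h1 h2.
by split; rewrite ?ler_norml; try (apply/andP; split); lra.
Qed.

Lemma pos_root_ge0 c i : c \in pos_roots -> 0 <= c`_i.
Proof.
have /allP H : all (all (fun x => 0 <= x)) pos_roots by vm_compute.
move=> /H /(all_nthP 0) c_ge0.
by case: (ltnP i (size c)) => [/c_ge0|/(nth_default 0) ->].
Qed.

Lemma dominant_root_ge0 mu c : dominant mu -> c \in pos_roots ->
  0 <= dot mu (root c).
Proof.
move=> mu_dom cP; rewrite dot_root big_seq; apply: sumr_ge0 => i.
by rewrite mem_iota => i6; rewrite mulr_ge0 ?mu_dom // ler0z pos_root_ge0.
Qed.

Lemma abs_root_sum_dominant mu : dominant mu -> abs_root_sum mu = root_sum mu.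
Proof.
move=> mu_dom; apply: eq_big_seq => c cP.
by rewrite ger0_norm // dominant_root_ge0.
Qed.

Lemma root_sum_le_abs_root_sum mu : root_sum mu <= abs_root_sum mu.
Proof. by apply: ler_sum => c _; apply: ler_norm. Qed.

Definition integral mu :=
  forall i, (i < 6)%N -> dot mu (simple i) \is a Num.int.

Lemma simple_generator i : (i < 6)%N -> is_generator_root (simple i).
Proof.
case: i => [|[|[|[|[|[|i]]]]]] // _; [by right| left ..].
- by exists 2%N, 1%N; do 2!split=> //; left.
- by exists 2%N, 1%N; do 2!split=> //; right.
- by exists 3%N, 2%N; do 2!split=> //; right.
- by exists 4%N, 3%N; do 2!split=> //; right.
- by exists 5%N, 4%N; do 2!split=> //; right.
Qed.

Lemma reflection_simple i mu : (i < 6)%N ->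
  reflection (simple i) mu = mu - dot mu (simple i) *: simple i.
Proof.
move=> i6; rewrite /reflection dot_simple // /cartan eqxx.
by congr (_ - _ *: _); field.
Qed.

(** Reflecting in a simple root of negative pairing fixes N and raises [root_sum], so the
    nonnegative gap between them shrinks. The induction is on a natural bound for this gap. *)
Lemma exists_dominant mu : integral mu ->
  exists w, Wk w /\ dominant (w mu).
Proof.
have [n] : exists n : nat, abs_root_sum mu - root_sum mu < n%:R.
  exists (Num.bound (abs_root_sum mu - root_sum mu)).
  by rewrite archi_boundP // subr_ge0 root_sum_le_abs_root_sum.
elim: n mu => [|n IH] mu.
  by rewrite ltNge subr_ge0 root_sum_le_abs_root_sum.
move=> mu_lt mu_int.
have [mu_dom|/existsNP[i /not_implyP[i6 /negP]]] := pselect (dominant mu).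
  by exists id; split => //; apply: Wk_id.
rewrite -ltNge => mui_lt0.
(* The gap changes by twice this pairing, hence drops by at least 2. *)
have mui_le : dot mu (simple i) <= -1.
  have /intrP[z zE] := mu_int i i6.
  by move: mui_lt0; rewrite zE ltrz0 -[-1]/((-1)%:~R) ler_int -ltzD1.
have si := Wk_refl (simple_generator i6).
have [|j j6|w [wW w_dom]] := IH (reflection (simple i) mu).
- case: (Wk_invariants si mu) => -> _ _; move: mu_lt.
  rewrite !root_sum_rho reflection_simple // !dotBl !dotZl.
  rewrite (dotC (simple i)) dot_simple_rho // (dotC (simple i)).
  rewrite dot_s3_simple //.
  by rewrite -natr1; lra.
- rewrite reflection_simple // dotBl dotZl dot_simple //.
  by rewrite rpredB ?mu_int // rpredM ?mu_int // intr_int.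
- by exists (w \o reflection (simple i)); split => //; apply: Wk_comp.
Qed.

Lemma enorm_dominant_rho mu : dominant mu ->
  enorm (mu + rho) ^+ 2 =
  dot mu mu + abs_root_sum mu + 9 * dot mu (s3 R) + dot (@rho R) rho.
Proof.
move=> /abs_root_sum_dominant ->.
rewrite root_sum_rho enorm_sqr !(dotDl, dotDr).
by rewrite (dotC rho mu); ring.
Qed.

Lemma enorm_dominant_conj_rho mu : integral mu ->
  enorm (dominant_conj mu + rho) ^+ 2 =
  dot mu mu + abs_root_sum mu + 9 * dot mu (s3 R) + dot (@rho R) rho.
Proof.
move=> /exists_dominant[w [wW /k_dominantP w_dom]].
(* The set is nonempty, so [xget] returns a dominant w' mu, and the invariants carry the formula
   back to mu. *)
rewrite /dominant_conj; case: xgetP => [nu _|/(_ (w mu))]; last first.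
  by case; split => //; exists w.
case=> -[w' [w'W ->]] /k_dominantP/enorm_dominant_rho ->.
by have [-> -> ->] := Wk_invariants w'W mu.
Qed.

(** * Highest weights and the lower bound for N *)

Lemma highest_weight_integral lambda : highest_weight lambda -> integral lambda.
Proof.
move=> [_ [_ [l_diff [l_half l_m]]]] i.
have l21 : coord lambda 2 + coord lambda 1 \is a Num.int.
  have -> : coord lambda 2 + coord lambda 1 =
    (coord lambda 2 - coord lambda 1) + 2 * coord lambda 1 by ring.
  by rewrite rpredD ?l_diff ?l_half.
rewrite dot_simpleE.
by case: i => [|[|[|[|[|[|i]]]]]] //= _; rewrite ?l_diff // intr_nat.
Qed.

Lemma highest_weight_dominant lambda : highest_weight lambda -> dominant lambda.
Proof.
move=> [_ [[h1 h2 h3 h4] [_ [_ l_m]]]]; apply/k_dominantP.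
by split => //; apply: natr_ge0.
Qed.

Lemma dot_s1_root c : dot s1 (root c) = (c`_0)%:~R.
Proof.
rewrite dot_root /= !big_cons big_nil !dot_s1_simple //=.
by rewrite !mulr0 mulr1 !addr0.
Qed.

Lemma dot_s2_root c : dot (s2 R) (root c) = (c`_5)%:~R.
Proof.
rewrite dot_root /= !big_cons big_nil !dot_s2_simple //=.
by rewrite !mulr0 mulr1 !add0r addr0.
Qed.

Lemma dot_schmid_root a b e c :
  dot (schmid a b e) (root c) = a%:R * (c`_0)%:~R + b%:R * (c`_5)%:~R.
Proof.
rewrite /schmid !dotDl !dotZl dot_s1_root dot_s2_root.
by rewrite (dotC (s3 R)) dot_root_s3 mulr0 addr0.
Qed.

Definition zeros lambda : bitseq :=
  [seq dot lambda (simple i) == 0 | i <- iota 0 6].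

Lemma nth_zeros lambda i : (i < 6)%N ->
  nth true (zeros lambda) i = (dot lambda (simple i) == 0).
Proof. by move=> i6; rewrite (nth_map 0%N) ?size_iota // nth_iota. Qed.

Lemma int_gt0_ge1 (x : R) : x \is a Num.int -> 0 < x -> 1 <= x.
Proof. by move=> /intrP[z ->]; rewrite ltr0z ler1z gtz0_ge1. Qed.

(** The pairing is a sum of nonnegative terms: either all vanish, or it is a positive integer. *)
Lemma sgnc_root lambda c : dominant lambda -> integral lambda ->
  c \in pos_roots ->
  sgnc (zeros lambda) c = -1 /\ dot lambda (root c) = 0 \/
  sgnc (zeros lambda) c = 1 /\ 1 <= dot lambda (root c).
Proof.
move=> l_dom l_int cP; rewrite /sgnc; case: ifP => [/allP c0|].
  left; split=> //; rewrite dot_root big1_seq // => i /andP[_ i6].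
  have := c0 i i6; move: i6; rewrite mem_iota => i6.
  by rewrite nth_zeros // => /orP[/eqP ->|/eqP ->]; rewrite ?mulr0 ?mul0r.
move=> /allPn[i i6 ic]; right; split=> //.
have c_int : dot lambda (root c) \is a Num.int.
  rewrite dot_root big_seq; apply: rpred_sum => j; rewrite mem_iota => j6.
  by rewrite rpredM ?intr_int ?l_int.
apply: int_gt0_ge1 => //; rewrite dot_root (bigD1_seq i) ?iota_uniq //.
rewrite mem_iota in i6; move: ic; rewrite negb_or nth_zeros // => /andP[li ci].
apply: ltr_wpDr.
  rewrite big_seq_cond; apply: sumr_ge0 => j; rewrite mem_iota => /andP[j6 _].
  by rewrite mulr_ge0 ?l_dom // ler0z pos_root_ge0.
by rewrite mulr_gt0 // lt0r ?li ?l_dom // intr_eq0 ci ler0z pos_root_ge0.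
Qed.

(** Rootwise, with p and x the pairings of lambda and nu: |p - x| >= p - x always, and |p - x| >= x
    if p = 0. *)
Lemma abs_root_sum_sub_ge lambda nu : dominant lambda -> integral lambda ->
  abs_root_sum lambda - \sum_(c <- pos_roots)
    (sgnc (zeros lambda) c)%:~R * dot nu (root c) <= abs_root_sum (lambda - nu).
Proof.
move=> l_dom l_int; rewrite -sumrB big_seq [leRHS]big_seq.
apply: ler_sum => c cP; rewrite dotBl.
have [[-> ->]|[-> lc]] := sgnc_root l_dom l_int cP.
  by rewrite normr0 !sub0r normrN mulN1r opprK ler_norm.
by rewrite mul1r ger0_norm ?(le_trans ler01 lc) // ler_norm.
Qed.

(** alpha_1 has coefficient 0 or 1 in each positive root, which never exceeds a nonzero pairing with
    lambda. *)
Lemma abs_root_sum_sub_s1 lambda : dominant lambda -> integral lambda ->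
  abs_root_sum (lambda - s1) =
  abs_root_sum lambda - (sgnsum (zeros lambda) 0)%:~R.
Proof.
move=> l_dom l_int; rewrite isum_intr -sumrB; apply: eq_big_seq => c cP.
have /allP /(_ c cP) c0 : all (fun c => (0 <= c`_0) && (c`_0 <= 1)) pos_roots
  by vm_compute.
rewrite dotBl dot_s1_root intrM.
have [c0_ge0 c0_le1] : 0 <= (c`_0)%:~R :> R /\ (c`_0)%:~R <= 1 :> R.
  by rewrite ler0z lerz1; apply/andP.
have [[-> ->]|[-> lc]] := sgnc_root l_dom l_int cP.
  by rewrite normr0 !sub0r normrN ger0_norm // mulN1r opprK.
by rewrite mul1r !ger0_norm //; lra.
Qed.

(** Orthogonality to the first five simple roots would force m(lambda) = 0 and lambda_1 = ... =
    lambda_4 = 0. *)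
Lemma case3_zeros lambda : highest_weight lambda -> case3 lambda ->
  ~~ all id (take 5 (zeros lambda)).
Proof.
move=> [_ [[h1 _ _ _] _]] l3; apply/negP => /= /and5P[].
rewrite !dot_simpleE /= => /eqP e0 /eqP e1 /eqP e2 /eqP e3 /andP[/eqP e4 _].
by case: l3 => [|[_ [|[[]|[[]|[[]|[[]|[]]]]]]]]; lra.
Qed.

End E7.

(** * Comparison with the basic inequality *)

Theorem theorem2p17 (R : realType) (lambda : 'rV[R]_8)
  (lambda_hw : highest_weight lambda)
  (lambda_case3 : case3 lambda)
  (basic_dirac :
     enorm (dominant_conj (lambda - s1) + rho) ^+ 2
       > enorm (lambda + rho) ^+ 2) :
  forall a b c : nat, (a, b, c) <> (0, 0, 0)%N ->
    enorm (dominant_conj (lambda - schmid a b c) + rho) ^+ 2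
      > enorm (lambda + rho) ^+ 2.
Proof.
move=> a b c abc0.
(* With these weights, n s1 and s_{a,b,c} have the same pairing with s3. *)
have n_ge1 : 1 <= a%:R + 2 * b%:R + 3 * c%:R :> R.
  rewrite -!natrM -!natrD ler1n.
  by case: a b c abc0 => [|a] [|b] [|c].
have l_dom := highest_weight_dominant lambda_hw.
have l_int := highest_weight_integral lambda_hw.
have s_int : integral (lambda - schmid a b c).
  move=> i i6; rewrite /schmid dotBl !dotDl !dotZl.
  rewrite dot_s1_simple // dot_s2_simple // dot_s3_simple // mulr0 addr0.
  by rewrite -!natrM -natrD rpredB ?l_int // natr_int.
have s1_int : integral (lambda - s1).
  by move=> i i6; rewrite dotBl dot_s1_simple // rpredB ?l_int // natr_int.
have N_ge := abs_root_sum_sub_ge (schmid a b c) l_dom l_int.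
have LE : \sum_(e <- pos_roots)
    (sgnc (zeros lambda) e)%:~R * dot (schmid a b c) (root R e) =
  a%:R * (sgnsum (zeros lambda) 0)%:~R + b%:R * (sgnsum (zeros lambda) 5)%:~R.
  rewrite !isum_intr !mulr_sumr -big_split; apply: eq_bigr => e _ /=.
  by rewrite dot_schmid_root !intrM; ring.
rewrite {}LE in N_ge.
have [|A_ge0 B_le] := sgnsum_bounds _ (case3_zeros lambda_hw lambda_case3).
  by rewrite size_map.
move: A_ge0 B_le.
move: basic_dirac.
rewrite (enorm_dominant_rho l_dom) !enorm_dominant_conj_rho //.
rewrite abs_root_sum_sub_s1 //.
move: N_ge; set A := sgnsum _ 0; set B := sgnsum _ 5.
rewrite -(ler_int R 0) -(ler_int R B) intrM.
move: A%:~R B%:~R (abs_root_sum (lambda - _)) => {}A {}B N N_ge + A_ge0 B_le.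
(* m(lambda) >= 0 gives 2 lambda_8 - lambda_5 - lambda_6 >= lambda_2 + lambda_3 + lambda_4 -
   lambda_1 >= 0. *)
have [x_y x_z] : dot lambda (s2 R) <= 2 * dot lambda s1 /\
    dot lambda (s3 R) <= 3 * dot lambda s1.
  have [l8 [[h1 h2 h3 h4] _]] := lambda_hw.
  have := l_dom 0%N isT; rewrite dot_simpleE /= /m => m_ge0.
  move: h1; rewrite ler_norml => /andP[h1 h1'].
  by rewrite !dotE !coord_simpl //=; lra.
rewrite /schmid !(dotBl, dotBr, dotDl, dotDr, dotZl, dotZr).
rewrite !(dotC _ lambda) (dotC (s2 R) s1) (dotC (s3 R) s1) (dotC (s3 R) (s2 R)).
have -> : dot s1 s1 = 2 :> R by rewrite dotE !coord_simpl //=; ring.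
have -> : dot s1 (s2 R) = 2 by rewrite dotE !coord_simpl //=; ring.
have -> : dot s1 (s3 R) = 2 by rewrite dotE !coord_simpl //=; ring.
have -> : dot (s2 R) (s2 R) = 4 by rewrite dotE !coord_simpl //=; ring.
have -> : dot (s2 R) (s3 R) = 4 by rewrite dotE !coord_simpl //=; ring.
have -> : dot (s3 R) (s3 R) = 6 by rewrite dotE !coord_simpl //=; ring.
move: (dot lambda s1) (dot lambda (s2 R)) (dot lambda (s3 R)) x_y x_z.
move=> x y z x_y x_z basic.
(* This yields |s_{a,b,c}|^2 >= n |s1|^2. *)
have sqr_ge k : k%:R <= k%:R * k%:R :> R
  by rewrite -natrM ler_nat; case: k => // k; apply: leq_pmulr.
have [[a2 b2] c2] := (sqr_ge a, sqr_ge b, sqr_ge c).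
(* n times the basic inequality, where 2 = |s1|^2 and 18 = 9 <s1, s3>. *)
have key : 0 < (a%:R + 2 * b%:R + 3 * c%:R) * (2 - 2 * x - A - 18).
  by apply: mulr_gt0; lra.
have b_xy : 0 <= b%:R * (2 * x - y) by apply: mulr_ge0; rewrite ?ler0n //; lra.
have b_AB : 0 <= b%:R * (2 * A - B) by apply: mulr_ge0; rewrite ?ler0n //; lra.
have c_xz : 0 <= c%:R * (3 * x - z) by apply: mulr_ge0; rewrite ?ler0n //; lra.
have c_A : 0 <= c%:R * A by apply: mulr_ge0; rewrite ?ler0n //; lra.
have ab_ge0 : 0 <= a%:R * b%:R :> R by rewrite mulr_ge0 ?ler0n.
have ac_ge0 : 0 <= a%:R * c%:R :> R by rewrite mulr_ge0 ?ler0n.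
have bc_ge0 : 0 <= b%:R * c%:R :> R by rewrite mulr_ge0 ?ler0n.
(* Beyond [key] the goal needs 2b(2x - y) + 2c(3x - z) + b(2A - B) + 3cA + |s_{a,b,c}|^2 - 2n >=
   0. *)
lra.
Qed.
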